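(* For every graph $H$ we have $\operatorname{box}_f(H) = 1$ if $H^c \in \mathcal{C}$, and $\operatorname{box}_f(H) = \infty$ otherwise.
   Context: All graphs are finite and simple; $H^c$ denotes the complement of a graph $H$. An interval graph is an intersection graph of intervals on the real line; a co-interval graph is the complement of an interval graph. $\mathcal{C}$ denotes the class of all co-interval graphs. A graph homomorphism $\varphi: G \to H$ is a map $V(G)\to V(H)$ such that $uv\in E(G)$ implies $\varphi(u)\varphi(v)\in E(H)$. For a graph class $\mathcal{G}$, a graph $H$ and a positive integer $t$, a $t$-global $\mathcal{G}$-cover of $H$ is an edge-surjective homomorphism $\varphi: G_1 \sqcup \cdots \sqcup G_t \to H$ (vertex-disjoint union) with $G_i\in\mathcal{G}$ for all $i$; it is $s$-local if $|\varphi^{-1}(v)|\le s$ for every $v\in V(H)$. The folded covering number $c_f^{\mathcal{G}}(H)$ is the minimum $s$ such that there exists a $1$-global $s$-local $\mathcal{G}$-cover of $H$ (the minimum of the empty set being $\infty$). Define $\operatorname{box}_f(H) := c_f^{\mathcal{C}}(H^c)$. *)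

(* Defs.v *)
From HB Require Import structures.
From mathcomp Require Import all_boot all_order all_algebra.
From mathcomp Require Import all_classical all_reals.

Set Implicit Arguments.
Unset Strict Implicit.
Unset Printing Implicit Defensive.

Local Open Scope classical_set_scope.

Record sgraph := SGraph {
  vertex :> finType;
  adj : rel vertex;
  adj_sym : symmetric adj;
  adj_irr : irreflexive adj }.

Arguments adj {s}.

Section Complement.
Variable G : sgraph.

Definition compl_adj : rel G := fun x y => (x != y) && ~~ adj x y.

Fact compl_adj_sym : symmetric compl_adj.
Proof. by move=> x y; rewrite /compl_adj eq_sym adj_sym. Qed.

Fact compl_adj_irr : irreflexive compl_adj.
Proof. by move=> x; rewrite /compl_adj eqxx. Qed.

Definition compl : sgraph := SGraph compl_adj_sym compl_adj_irr.
End Complement.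

Section DisjointUnion.
Variables (t : nat) (G : 'I_t -> sgraph).

Definition dunion_adj : rel {i : 'I_t & G i} :=
  fun u v => (tag u == tag v) && adj (tagged u) (tagged_as u v).

Fact dunion_adj_sym : symmetric dunion_adj.
Proof.
move=> [i x] [j y]; rewrite /dunion_adj /= eq_sym.
by case: eqP => //= eij; case: _ / eij x => x; rewrite !tagged_asE adj_sym.
Qed.

Fact dunion_adj_irr : irreflexive dunion_adj.
Proof. by move=> [i x]; rewrite /dunion_adj /= tagged_asE adj_irr andbF. Qed.

Definition dunion : sgraph := SGraph dunion_adj_sym dunion_adj_irr.
End DisjointUnion.

(* Intervals may be open, closed, half-open or unbounded, but not empty. *)
Definition interval_graph (R : realType) (G : sgraph) : Prop :=
  exists I : G -> interval R,
    (forall x, [set` I x] !=set0) /\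
    (forall x y, x != y -> (adj x y <-> [set` I x] `&` [set` I y] !=set0)).

Definition co_interval_graph (R : realType) (G : sgraph) : Prop :=
  interval_graph R (compl G).

Definition homomorphism (G H : sgraph) (phi : G -> H) : Prop :=
  forall x y, adj x y -> adj (phi x) (phi y).

Definition edge_surjective (G H : sgraph) (phi : G -> H) : Prop :=
  forall u v, adj u v -> exists x y, [/\ adj x y, phi x = u & phi y = v].

Definition global_cover (C : sgraph -> Prop) (t : nat) (G : 'I_t -> sgraph)
    (H : sgraph) (phi : dunion G -> H) : Prop :=
  [/\ forall i, C (G i), homomorphism phi & edge_surjective phi].

Definition local_cover (s : nat) (G H : sgraph) (phi : G -> H) : Prop :=
  forall v, #|[pred x | phi x == v]| <= s.

(* Minimum of a set of natural numbers, the minimum of the empty set being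
   infinity; the value -oo of \bar nat is never taken. *)
Definition min_nat (A : set nat) : \bar nat :=
  match pselect (exists n, `[< A n >]) with
  | left exA => (ex_minn exA)%:E
  | right _ => +oo%E
  end.

(* The parameter s ranges over positive integers: covers need not be
   vertex-surjective, so an edgeless H has a 0-local cover by the graph
   without vertices, and s = 0 must be excluded. *)
Definition folded_cover_number (C : sgraph -> Prop) (H : sgraph) : \bar nat :=
  min_nat [set s | 0 < s /\
    exists (G : 'I_1 -> sgraph) (phi : dunion G -> H),
      global_cover C phi /\ local_cover s phi].

Definition box_f (R : realType) (H : sgraph) : \bar nat :=
  folded_cover_number (co_interval_graph R) (compl H).

(* Main.v *)
Require Import Defs.
From HB Require Import structures.
From mathcomp Require Import all_boot all_order all_algebra.
From mathcomp Require Import all_classical all_reals.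

(* Let the intervals [I x] represent a co-interval graph G (adjacent means
   disjoint), and let [phi : G -> H] be an edge-surjective homomorphism. For
   non-adjacent [u], [v] in H, possibly [u = v], the vertices in the fibres of
   [u] and [v] are pairwise non-adjacent in G, so their intervals pairwise
   meet. By the Helly property of intervals, assigning to [v] the intersection
   of the [I x], [x] in the fibre of [v], represents H as a co-interval graph.
   So a folded cover exists only if the covered graph is itself co-interval,
   and then the identity is one. *)

Set Implicit Arguments.
Unset Strict Implicit.

Import Order.TTheory.

Section Helly.
Local Open Scope classical_set_scope.
Local Open Scope order_scope.
Context {d : Order.disp_t} {T : orderType d}.
Implicit Types I J K : interval T.

Lemma mem_itv_convex I (a b c : T) :
  a \in I -> c \in I -> a <= b -> b <= c -> b \in I.
Proof.
case: I => l r; rewrite !itv_boundlr => /andP[la _] /andP[_ cr] ab bc.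
apply/andP; split; first by apply: le_trans la _; rewrite bnd_simp.
by apply: le_trans _ cr; rewrite bnd_simp.
Qed.

(* The median of one point from each pairwise intersection is in all three. *)
Lemma itv_helly3 I J K :
  [set` I] `&` [set` J] !=set0 -> [set` I] `&` [set` K] !=set0 ->
  [set` J] `&` [set` K] !=set0 -> [set` I `&` J] `&` [set` K] !=set0.
Proof.
move=> [a /= [aI aJ]] [b /= [bI bK]] [c /= [cJ cK]].
suff [m [mI mJ mK]] : exists m, [/\ m \in I, m \in J & m \in K].
  by exists m; split => //=; rewrite in_itvI mI mJ.
have [ab|/ltW ba] := leP a b; have [bc|/ltW cb] := leP b c;
  have [ac|/ltW ca] := leP a c.
- by exists b; split=> //; apply: mem_itv_convex aJ cJ ab bc.
- by exists a; split=> //; apply: mem_itv_convex cK bK ca ab.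
- by exists c; split=> //; apply: mem_itv_convex aI bI ac cb.
- by exists a; split=> //; apply: mem_itv_convex cK bK ca ab.
- by exists a; split=> //; apply: mem_itv_convex bK cK ba ac.
- by exists c; split=> //; apply: mem_itv_convex bI aI bc ca.
- by exists b; split=> //; apply: mem_itv_convex cJ aJ cb ba.
- by exists b; split=> //; apply: mem_itv_convex cJ aJ cb ba.
Qed.

(** Induction on [r] with [K] generalised: each [F x] is absorbed into [K], and [itv_helly3] ensures
    that the smaller [K] still meets all the remaining intervals. *)
Lemma itv_helly (X : Type) (r : seq X) (P : pred X) (F : X -> interval T) K :
  [set` K] !=set0 ->
  (forall x, P x -> [set` K] `&` [set` F x] !=set0) ->
  (forall x y, P x -> P y -> [set` F x] `&` [set` F y] !=set0) ->
  [set` K] `&` [set` \meet_(x <- r | P x) F x] !=set0.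
Proof.
move=> K0 KF FF; elim: r K K0 KF => [|x r IHr] K K0 KF.
  by rewrite big_nil; case: K0 => a aK; exists a; split.
rewrite big_cons; case: ifPn => Px; last exact: IHr.
rewrite set_itvI setIA -set_itvI; apply: IHr.
  by rewrite set_itvI; apply: KF.
by move=> y Py; apply: itv_helly3; [apply: KF | apply: KF | apply: FF].
Qed.

Lemma mem_meets_itv (X : finType) (P : pred X) (F : X -> interval T) x a :
  P x -> a \in \meet_(y | P y) F y -> a \in F x.
Proof. by move=> Px; apply: subitvP; apply: meets_inf. Qed.

End Helly.

Section CoInterval.
Local Open Scope classical_set_scope.
Variable R : realType.
Implicit Types G H : sgraph.

(** Since [adj] is irreflexive, the case [x = y] of the equivalence says that [I x] is nonempty, so
    one condition replaces the two of the definition. *)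
Lemma co_interval_graphP G :
  co_interval_graph R G <->
  exists I : G -> interval R,
    forall x y, ~~ adj x y <-> [set` I x] `&` [set` I y] !=set0.
Proof.
split=> [[I [I0 Iadj]]|[I Iadj]]; exists I.
  move=> x y; have [->|xy] := eqVneq x y; first by rewrite adj_irr setIid.
  by rewrite -Iadj // /adj /= /compl_adj xy.
split=> [x|x y xy]; first by rewrite -[[set` _]]setIid -Iadj adj_irr.
by rewrite -Iadj /adj /= /compl_adj xy.
Qed.

Lemma co_interval_graph_image G H (phi : G -> H) :
  homomorphism phi -> edge_surjective phi ->
  co_interval_graph R G -> co_interval_graph R H.
Proof.
move=> hom esurj /co_interval_graphP[I Iadj]; apply/co_interval_graphP.
have II x y : ~~ adj (phi x) (phi y) -> [set` I x] `&` [set` I y] !=set0.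
  by move=> nxy; apply/Iadj; apply: contra nxy; apply: hom.
pose J v := (\meet_(x | phi x == v) I x)%O.
have fibre (K : interval R) v : [set` K] !=set0 ->
    (forall x, phi x = v -> [set` K] `&` [set` I x] !=set0) ->
    [set` K] `&` [set` J v] !=set0.
  move=> K0 KI; apply: itv_helly => // [x /eqP|x y /eqP xv /eqP yv].
    exact: KI.
  by apply: II; rewrite xv yv adj_irr.
have I0 x : [set` I x] !=set0.
  by rewrite -[[set` _]]setIid; apply/Iadj; rewrite adj_irr.
(* Taking the whole line for [K] also covers an empty fibre, where [J v] is [\top]; [phi] may miss
   isolated vertices. *)
have J0 v : [set` J v] !=set0.
  have [a []] : [set` (\top : interval R)%O] `&` [set` J v] !=set0.
    apply: fibre; first by exists 0%R.
    by move=> x _; have [a ax] := I0 x; exists a.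
  by exists a.
exists J => u v; split=> [nuv|[a /= [au av]]].
  (* Helly is applied twice: over the fibre of [v] with [K := J u], then for each [y] there over the
     fibre of [u] with [K := I y]. *)
  apply: (fibre _ v) => // y yv; rewrite setIC; apply: fibre => // x xu.
  by apply: II; rewrite xu yv adj_sym.
(* An edge [uv] lifts to an edge [xy], whose disjoint intervals would both contain [a]. *)
apply/negP => /esurj[x [y [xy xu yv]]].
suff : ~~ adj x y by rewrite xy.
apply/Iadj; exists a; split => /=.
  by apply: mem_meets_itv au; apply/eqP.
by apply: mem_meets_itv av; apply/eqP.
Qed.

End CoInterval.

Lemma dunion_adjE (t : nat) (G : 'I_t -> sgraph) i (x y : G i) :
  @adj (dunion G) (existT _ i x) (existT _ i y) = adj x y.
Proof. by rewrite [LHS]/= /dunion_adj /= eqxx tagged_asE. Qed.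

Section FoldedCover.
Variable C : sgraph -> Prop.
Implicit Type H : sgraph.

(** [C] is not assumed invariant under isomorphism, so the cover is moved from [dunion G] to its
    only summand, where membership in [C] is known. *)
Lemma global_cover1_image H (G : 'I_1 -> sgraph) (phi : dunion G -> H) :
  global_cover C phi ->
  exists psi : G ord0 -> H,
    [/\ C (G ord0), homomorphism psi & edge_surjective psi].
Proof.
move=> [CG hom esurj]; exists (fun x => phi (existT _ ord0 x)); split => //.
  by move=> x y xy; apply: hom; rewrite dunion_adjE.
move=> u v /esurj[[i x] [[j y] []]]; move: x y.
rewrite (ord1 i) (ord1 j) => x y; rewrite dunion_adjE => xy <- <-.
by exists x, y.
Qed.

Lemma global_cover1_id H :
  C H -> exists phi : dunion (fun _ : 'I_1 => H) -> H,
    global_cover C phi /\ local_cover 1 phi.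
Proof.
move=> CH; exists (fun x => tagged x); split; first split => //.
- move=> [i x] [j y]; rewrite (ord1 i) (ord1 j).
  by rewrite (@dunion_adjE 1 (fun=> H)).
- move=> u v uv; exists (existT _ ord0 u), (existT _ ord0 v); split => //.
  by rewrite (@dunion_adjE 1 (fun=> H)).
- move=> v; pose v0 : dunion (fun _ : 'I_1 => H) := existT _ ord0 v.
  rewrite -[X in (_ <= X)%N](card1 v0).
  apply/subset_leq_card/fintype.subsetP => -[i x].
  by rewrite /v0 !inE /= => /eqP <-; rewrite (ord1 i).
Qed.

Lemma folded_cover_number1 H : C H -> folded_cover_number C H = 1%N%:E.
Proof.
move=> CH; rewrite /folded_cover_number /min_nat; case: pselect => [exA|nA].
  case: ex_minnP => m /asboolP[m0 _] minm; congr EFin.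
  (* Positivity [m0] gives the lower bound, the identity cover the upper one. *)
  apply/eqP; rewrite eqn_leq m0 andbT; apply: minm; apply/asboolP; split => //.
  by exists (fun=> H); apply: global_cover1_id.
exfalso; apply: nA; exists 1%N; apply/asboolP; split => //.
by exists (fun=> H); apply: global_cover1_id.
Qed.

Lemma folded_cover_number_infty H :
  (forall (G : sgraph) (phi : G -> H),
    homomorphism phi -> edge_surjective phi -> ~ C G) ->
  folded_cover_number C H = +oo%E.
Proof.
move=> nC; rewrite /folded_cover_number /min_nat; case: pselect => // exA.
exfalso; move: exA => [s /asboolP[_ [G [phi [cover _]]]]].
have [psi [CG hom esurj]] := global_cover1_image cover.
by case: (nC _ psi hom esurj).
Qed.

End FoldedCover.

Theorem theorem2 (R : realType) (H : sgraph) :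
  (co_interval_graph R (compl H) -> box_f R H = 1%N%:E) /\
  (~ co_interval_graph R (compl H) -> box_f R H = +oo%E).
Proof.
split=> [|nH]; first exact: folded_cover_number1.
apply: folded_cover_number_infty => G phi hom esurj CG.
by apply: nH; apply: co_interval_graph_image hom esurj CG.
Qed.
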